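(* If a unital category is coherent, then it is trivial, i.e. every object of it is a zero object.
   Context: A pointed finitely complete category is unital if for any pair of objects $X$, $Y$ the cospan $(\langle 1_X,0\rangle\colon X\to X\times Y,\ \langle 0,1_Y\rangle\colon Y\to X\times Y)$ is jointly strongly epimorphic. A cospan $(f\colon X\to Z,\ g\colon Y\to Z)$ in a category with finite limits is jointly strongly epimorphic if every monomorphism into $Z$ through which both $f$ and $g$ factor is an isomorphism. A functor between categories with finite limits is coherent if it preserves finite limits and jointly strongly epimorphic pairs. A regular category $\mathcal{C}$ with finite coproducts is a coherent category if for every morphism $f\colon X\to Y$ in $\mathcal{C}$ the change-of-base (pullback) functor $f^*\colon(\mathcal{C}\downarrow Y)\to(\mathcal{C}\downarrow X)$ between slice categories is coherent. *)

(* Defs.v *)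
From Stdlib Require Import List FinFun ProofIrrelevance ClassicalEpsilon.

Set Implicit Arguments.
Unset Strict Implicit.
Unset Printing Implicit Defensive.

Record Category := {
  Ob :> Type;
  Hom : Ob -> Ob -> Type;
  idm : forall X : Ob, Hom X X;
  comp : forall X Y Z : Ob, Hom Y Z -> Hom X Y -> Hom X Z;
  comp_id_l : forall (X Y : Ob) (f : Hom X Y), comp (idm Y) f = f;
  comp_id_r : forall (X Y : Ob) (f : Hom X Y), comp f (idm X) = f;
  comp_assoc : forall (W X Y Z : Ob) (h : Hom Y Z) (g : Hom X Y) (f : Hom W X),
    comp h (comp g f) = comp (comp h g) f
}.
Arguments Hom {c} X Y.
Arguments idm {c} X.
Arguments comp {c X Y Z} g f : rename.

Declare Scope cat_scope.
Open Scope cat_scope.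
Notation "g ∘ f" := (comp g f) (at level 40, left associativity) : cat_scope.

Record Functor (C D : Category) := {
  fob :> C -> D;
  fmap : forall X Y : C, Hom X Y -> Hom (fob X) (fob Y);
  fmap_id : forall X : C, fmap (idm X) = idm (fob X);
  fmap_comp : forall (X Y Z : C) (g : Hom Y Z) (f : Hom X Y),
    fmap (g ∘ f) = fmap g ∘ fmap f
}.
Arguments fmap {C D} F {X Y} f : rename.

Definition functor_comp (C D E : Category) (G : Functor D E) (F : Functor C D) :
  Functor C E.
Proof.
refine {| fob := fun X => G (F X);
          fmap := fun X Y (f : Hom X Y) => fmap G (fmap F f) |}.
- intros X; now rewrite !fmap_id.
- intros X Y Z g f; now rewrite !fmap_comp.
Defined.

Definition is_iso (C : Category) (X Y : C) (f : Hom X Y) : Prop :=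
  exists g : Hom Y X, g ∘ f = idm X /\ f ∘ g = idm Y.

Definition is_mono (C : Category) (X Y : C) (m : Hom X Y) : Prop :=
  forall (W : C) (u v : Hom W X), m ∘ u = m ∘ v -> u = v.

Definition is_initial (C : Category) (X : C) : Prop :=
  forall Y : C, exists! f : Hom X Y, True.

Definition is_terminal (C : Category) (X : C) : Prop :=
  forall Y : C, exists! f : Hom Y X, True.

Definition is_zero (C : Category) (X : C) : Prop :=
  is_initial X /\ is_terminal X.

Definition pointed (C : Category) : Prop := exists Z : C, is_zero Z.

Definition is_zero_morphism (C : Category) (X Y : C) (f : Hom X Y) : Prop :=
  exists (Z : C) (u : Hom X Z) (v : Hom Z Y), is_zero Z /\ f = v ∘ u.

Definition jointly_strongly_epic (C : Category) (X Y Z : C)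
    (f : Hom X Z) (g : Hom Y Z) : Prop :=
  forall (M : C) (m : Hom M Z), is_mono m ->
    (exists f' : Hom X M, m ∘ f' = f) ->
    (exists g' : Hom Y M, m ∘ g' = g) ->
    is_iso m.

Record Cone (J C : Category) (D : Functor J C) := {
  apex : C;
  leg : forall j : J, Hom apex (D j);
  leg_natural : forall (i j : J) (a : Hom i j), fmap D a ∘ leg i = leg j
}.
Arguments apex {J C D} c : rename.
Arguments leg {J C D} c j : rename.

Definition is_limit (J C : Category) (D : Functor J C) (c : Cone D) : Prop :=
  forall c' : Cone D,
    exists! u : Hom (apex c') (apex c), forall j : J, leg c j ∘ u = leg c' j.

Definition finite_category (J : Category) : Prop :=
  Finite J /\ forall i j : J, Finite (Hom i j).

Definition has_finite_limits (C : Category) : Prop :=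
  forall (J : Category) (D : Functor J C), finite_category J ->
    exists c : Cone D, is_limit c.

Definition map_cone (J C D : Category) (F : Functor C D) (K : Functor J C)
  (c : Cone K) : Cone (functor_comp F K).
Proof.
refine (@Build_Cone _ _ (functor_comp F K) (F (apex c))
          (fun j => fmap F (leg c j)) _).
intros i j a; simpl; now rewrite <- fmap_comp, leg_natural.
Defined.

Definition preserves_finite_limits (C D : Category) (F : Functor C D) : Prop :=
  forall (J : Category) (K : Functor J C) (c : Cone K),
    finite_category J -> is_limit c -> is_limit (map_cone F c).

Definition preserves_jointly_strongly_epic_pairs (C D : Category)
    (F : Functor C D) : Prop :=
  forall (X Y Z : C) (f : Hom X Z) (g : Hom Y Z),
    jointly_strongly_epic f g ->
    jointly_strongly_epic (fmap F f) (fmap F g).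

Definition coherent_functor (C D : Category) (F : Functor C D) : Prop :=
  preserves_finite_limits F /\ preserves_jointly_strongly_epic_pairs F.

Definition is_product (C : Category) (X Y P : C)
    (p : Hom P X) (q : Hom P Y) : Prop :=
  forall (W : C) (f : Hom W X) (g : Hom W Y),
    exists! u : Hom W P, p ∘ u = f /\ q ∘ u = g.

(* The conditions on i and j say that i = <1,0> and j = <0,1>; they are imposed
   for every product cone (p, q), since products are only determined up to
   isomorphism. *)
Record unital (C : Category) : Prop := {
  unital_pointed : pointed C;
  unital_finite_limits : has_finite_limits C;
  unital_jointly_strongly_epic :
    forall (X Y P : C) (p : Hom P X) (q : Hom P Y), is_product p q ->
    forall (i : Hom X P) (j : Hom Y P),
      p ∘ i = idm X -> is_zero_morphism (q ∘ i) ->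
      is_zero_morphism (p ∘ j) -> q ∘ j = idm Y ->
      jointly_strongly_epic i j
}.

Definition is_pullback (C : Category) (X Y Z P : C) (f : Hom X Z) (g : Hom Y Z)
    (p : Hom P X) (q : Hom P Y) : Prop :=
  f ∘ p = g ∘ q /\
  forall (W : C) (h : Hom W X) (k : Hom W Y), f ∘ h = g ∘ k ->
    exists! u : Hom W P, p ∘ u = h /\ q ∘ u = k.

Definition is_coequalizer (C : Category) (X Y Q : C) (f g : Hom X Y)
    (e : Hom Y Q) : Prop :=
  e ∘ f = e ∘ g /\
  forall (W : C) (h : Hom Y W), h ∘ f = h ∘ g -> exists! u : Hom Q W, u ∘ e = h.

Definition is_regular_epi (C : Category) (Y Q : C) (e : Hom Y Q) : Prop :=
  exists (X : C) (f g : Hom X Y), is_coequalizer f g e.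

Record regular (C : Category) : Prop := {
  regular_finite_limits : has_finite_limits C;
  regular_coequalizers : forall (X Y K : C) (f : Hom X Y) (k1 k2 : Hom K X),
    is_pullback f f k1 k2 -> exists (Q : C) (e : Hom X Q), is_coequalizer k1 k2 e;
  regular_stable : forall (X Y Z P : C) (e : Hom X Z) (g : Hom Y Z)
      (p : Hom P X) (q : Hom P Y),
    is_pullback e g p q -> is_regular_epi e -> is_regular_epi q
}.

Definition is_coproduct (C : Category) (I : Type) (X : I -> C) (S : C)
    (inj : forall i : I, Hom (X i) S) : Prop :=
  forall (W : C) (f : forall i : I, Hom (X i) W),
    exists! u : Hom S W, forall i : I, u ∘ inj i = f i.

Definition has_finite_coproducts (C : Category) : Prop :=
  forall (I : Type) (X : I -> C), Finite I ->
    exists (S : C) (inj : forall i : I, Hom (X i) S), is_coproduct inj.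

Record Pullback (C : Category) (X Y Z : C) (f : Hom X Z) (g : Hom Y Z) := {
  pb_ob : C;
  pb_fst : Hom pb_ob X;
  pb_snd : Hom pb_ob Y;
  pb_universal : is_pullback f g pb_fst pb_snd
}.
Arguments pb_ob {C X Y Z f g} p : rename.
Arguments pb_fst {C X Y Z f g} p : rename.
Arguments pb_snd {C X Y Z f g} p : rename.

Inductive cospan_ob : Type := cs_left | cs_right | cs_tip.

Definition cospan_hom (i j : cospan_ob) : Type :=
  match i, j with
  | cs_left, cs_left | cs_right, cs_right | cs_tip, cs_tip
  | cs_left, cs_tip | cs_right, cs_tip => unit
  | _, _ => Empty_set
  end.

Definition cospan_category : Category.
Proof.
refine {| Ob := cospan_ob; Hom := cospan_hom;
          idm := fun i => match i return cospan_hom i i with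
                          | cs_left | cs_right | cs_tip => tt end;
          comp := fun i j k =>
            match i, j, k
              return cospan_hom j k -> cospan_hom i j -> cospan_hom i k with
            | cs_left, cs_left, k => fun b _ => b
            | cs_right, cs_right, k => fun b _ => b
            | cs_tip, cs_tip, k => fun b _ => b
            | cs_left, cs_tip, cs_tip => fun _ _ => tt
            | cs_right, cs_tip, cs_tip => fun _ _ => tt
            | _, _, _ => ltac:(simpl; now intros [] || now intros ? [])
            end |}.
- now intros [] [] [].
- now intros [] [] [].
- now intros [] [] [] [] [] [] [].
Defined.

Definition cospan_functor (C : Category) (X Y Z : C)
  (f : Hom X Z) (g : Hom Y Z) : Functor cospan_category C.
Proof.
refine (@Build_Functor cospan_category C
  (fun i => match i with cs_left => X | cs_right => Y | cs_tip => Z end)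
  (fun i j => match i, j return cospan_hom i j ->
       Hom (match i with cs_left => X | cs_right => Y | cs_tip => Z end)
           (match j with cs_left => X | cs_right => Y | cs_tip => Z end) with
     | cs_left, cs_left => fun _ => idm X
     | cs_right, cs_right => fun _ => idm Y
     | cs_tip, cs_tip => fun _ => idm Z
     | cs_left, cs_tip => fun _ => f
     | cs_right, cs_tip => fun _ => g
     | _, _ => ltac:(now intros [])
     end) _ _).
- now intros [].
- intros [] [] [] [] []; simpl; now rewrite ?comp_id_l, ?comp_id_r.
Defined.

Lemma finite_cospan_category : finite_category cospan_category.
Proof.
split.
- exists (cs_left :: cs_right :: cs_tip :: nil); intros []; simpl; tauto.
- intros [] []; simpl;
    first [ exists (tt :: nil); intros []; simpl; tauto
          | exists nil; intros [] ].
Qed.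

Lemma has_pullbacks (C : Category) (X Y Z : C) (f : Hom X Z) (g : Hom Y Z) :
  has_finite_limits C -> inhabited (Pullback f g).
Proof.
intros lim.
destruct (lim _ (cospan_functor f g) finite_cospan_category) as [c Hc].
pose proof (@leg_natural _ _ _ c cs_left cs_tip tt) as El.
pose proof (@leg_natural _ _ _ c cs_right cs_tip tt) as Er.
simpl in El, Er.
constructor.
apply (@Build_Pullback C X Y Z f g (apex c) (leg c cs_left) (leg c cs_right)).
split; [now rewrite El, Er|].
intros W h k E.
assert (N : forall (i j : cospan_category) (a : Hom i j),
  fmap (cospan_functor f g) a ∘
    match i return Hom W (cospan_functor f g i) with
    | cs_left => h | cs_right => k | cs_tip => f ∘ h end =
    match j return Hom W (cospan_functor f g j) with
    | cs_left => h | cs_right => k | cs_tip => f ∘ h end).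
{ intros [] [] []; simpl; rewrite ?comp_id_l; auto. }
destruct (Hc (Build_Cone N)) as [u [Hu Uu]]; simpl in u, Hu, Uu.
exists u; split.
- exact (conj (Hu cs_left) (Hu cs_right)).
- intros v [v1 v2]; apply Uu; intros []; auto.
  now rewrite <- El, <- comp_assoc, v1.
Qed.

(* Finite limits are assumed to exist but are not part of the structure, so the
   change-of-base functors use a choice of pullbacks; another choice gives
   isomorphic functors. *)
Definition chosen_pullback (C : Category) (lim : has_finite_limits C)
    (X Y Z : C) (f : Hom X Z) (g : Hom Y Z) : Pullback f g :=
  epsilon (has_pullbacks f g lim) (fun _ => True).

Definition pb_lift (C : Category) (X Y Z : C) (f : Hom X Z) (g : Hom Y Z)
    (P : Pullback f g) (W : C) (h : Hom W X) (k : Hom W Y) (E : f ∘ h = g ∘ k) :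
    {u : Hom W (pb_ob P) | pb_fst P ∘ u = h /\ pb_snd P ∘ u = k} :=
  constructive_definite_description _ (proj2 (pb_universal P) W h k E).

Lemma pb_ext (C : Category) (X Y Z : C) (f : Hom X Z) (g : Hom Y Z)
    (P : Pullback f g) (W : C) (u v : Hom W (pb_ob P)) :
  pb_fst P ∘ u = pb_fst P ∘ v -> pb_snd P ∘ u = pb_snd P ∘ v -> u = v.
Proof.
intros E1 E2.
destruct (pb_universal P) as [E U].
destruct (U W (pb_fst P ∘ v) (pb_snd P ∘ v)) as [w [_ Hw]].
- now rewrite !comp_assoc, E.
- transitivity w; [symmetry|]; apply Hw; auto.
Qed.

Record SliceOb (C : Category) (X : C) := {
  slice_dom : C;
  slice_arr : Hom slice_dom X
}.
Arguments slice_dom {C X} s : rename.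
Arguments slice_arr {C X} s : rename.

Definition slice_hom (C : Category) (X : C) (A B : SliceOb X) : Type :=
  {h : Hom (slice_dom A) (slice_dom B) | slice_arr B ∘ h = slice_arr A}.

Lemma slice_hom_eq (C : Category) (X : C) (A B : SliceOb X)
    (h k : slice_hom A B) :
  proj1_sig h = proj1_sig k -> h = k.
Proof.
destruct h as [h Hh], k as [k Hk]; simpl; apply subset_eq_compat.
Qed.

Definition slice (C : Category) (X : C) : Category.
Proof.
refine {| Ob := SliceOb X;
          Hom := @slice_hom C X;
          idm := fun A => exist _ (idm (slice_dom A)) (comp_id_r _);
          comp := fun A B D k h => exist _ (proj1_sig k ∘ proj1_sig h) _ |}.
- intros A B h; apply slice_hom_eq, comp_id_l.
- intros A B h; apply slice_hom_eq, comp_id_r.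
- intros A B D E l k h; apply slice_hom_eq, comp_assoc.
Unshelve.
abstract (rewrite comp_assoc, (proj2_sig k); exact (proj2_sig h)).
Defined.

Definition change_of_base_ob (C : Category) (lim : has_finite_limits C)
    (X Y : C) (f : Hom X Y) (A : slice Y) : slice X :=
  {| slice_arr := pb_snd (chosen_pullback lim (slice_arr A) f) |}.

Lemma change_of_base_square (C : Category) (lim : has_finite_limits C)
    (X Y : C) (f : Hom X Y) (A B : slice Y) (h : Hom A B) :
  slice_arr B ∘ (proj1_sig h ∘ pb_fst (chosen_pullback lim (slice_arr A) f)) =
  f ∘ pb_snd (chosen_pullback lim (slice_arr A) f).
Proof.
rewrite comp_assoc, (proj2_sig h).
exact (proj1 (pb_universal (chosen_pullback lim (slice_arr A) f))).
Qed.

Definition change_of_base_map (C : Category) (lim : has_finite_limits C)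
    (X Y : C) (f : Hom X Y) (A B : slice Y) (h : Hom A B) :
    Hom (change_of_base_ob lim f A) (change_of_base_ob lim f B) :=
  let u := pb_lift (chosen_pullback lim (slice_arr B) f)
             (change_of_base_square lim f h) in
  exist _ (proj1_sig u) (proj2 (proj2_sig u)).

Lemma change_of_base_map_fst (C : Category) (lim : has_finite_limits C)
    (X Y : C) (f : Hom X Y) (A B : slice Y) (h : Hom A B) :
  pb_fst (chosen_pullback lim (slice_arr B) f) ∘
    proj1_sig (change_of_base_map lim f h) =
  proj1_sig h ∘ pb_fst (chosen_pullback lim (slice_arr A) f).
Proof.
exact (proj1 (proj2_sig (pb_lift (chosen_pullback lim (slice_arr B) f)
  (change_of_base_square lim f h)))).
Qed.

Lemma change_of_base_map_eq (C : Category) (lim : has_finite_limits C)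
    (X Y : C) (f : Hom X Y) (A : slice X) (B : slice Y)
    (u v : Hom A (change_of_base_ob lim f B)) :
  pb_fst (chosen_pullback lim (slice_arr B) f) ∘ proj1_sig u =
  pb_fst (chosen_pullback lim (slice_arr B) f) ∘ proj1_sig v -> u = v.
Proof.
intros E; apply slice_hom_eq, pb_ext; [exact E|].
exact (eq_trans (proj2_sig u) (eq_sym (proj2_sig v))).
Qed.

Definition change_of_base (C : Category) (lim : has_finite_limits C)
  (X Y : C) (f : Hom X Y) : Functor (slice Y) (slice X).
Proof.
refine {| fob := change_of_base_ob lim f;
          fmap := @change_of_base_map C lim X Y f |}.
- intros A; apply change_of_base_map_eq; rewrite change_of_base_map_fst.
  exact (eq_trans (comp_id_l _) (eq_sym (comp_id_r _))).
- intros A B D k h; apply change_of_base_map_eq.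
  etransitivity; [apply change_of_base_map_fst|]; symmetry.
  etransitivity; [apply comp_assoc|].
  etransitivity;
    [exact (f_equal (fun a => a ∘ proj1_sig (change_of_base_map lim f h))
              (change_of_base_map_fst lim f k))|].
  etransitivity; [symmetry; apply comp_assoc|].
  etransitivity;
    [exact (f_equal (fun a => proj1_sig k ∘ a)
              (change_of_base_map_fst lim f h))|].
  apply comp_assoc.
Defined.

Record coherent_category (C : Category) : Prop := {
  coherent_regular : regular C;
  coherent_finite_coproducts : has_finite_coproducts C;
  coherent_change_of_base : forall (X Y : C) (f : Hom X Y),
    coherent_functor
      (change_of_base (regular_finite_limits coherent_regular) f)
}.

(* Main.v *)
Require Import Defs.

(** The inclusions [⟨1,0⟩] and [⟨0,1⟩] of [X] into [X × X] are jointly strongly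
    epic because the category is unital.  In a coherent category this property
    survives pulling back along any morphism into [X × X], in particular along
    the diagonal ([jointly_strongly_epic_pullback]).  But the axes [y = 0] and
    [x = 0] both meet the diagonal only in the origin, so both pullbacks are
    [0 -> X] ([axis_diagonal_pullback]).  Hence the single monomorphism
    [0 -> X] is strongly epic, that is, an isomorphism, and [X] is a zero
    object. *)

Set Implicit Arguments.
Unset Strict Implicit.
Unset Printing Implicit Defensive.

Lemma terminal_hom_eq (C : Category) (Z X : C) (u v : Hom X Z) :
  is_terminal Z -> u = v.
Proof.
intros t; destruct (t X) as [w [_ Uw]].
now rewrite <- (Uw u I), <- (Uw v I).
Qed.

Lemma initial_hom_eq (C : Category) (Z X : C) (u v : Hom Z X) :
  is_initial Z -> u = v.
Proof.
intros t; destruct (t X) as [w [_ Uw]].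
now rewrite <- (Uw u I), <- (Uw v I).
Qed.

(** The zero object in the definition of a zero morphism is existentially
    quantified; this moves the factorization to a prescribed one. *)
Lemma zero_morphism_factor (C : Category) (Z X Y : C) (f : Hom X Y)
    (u : Hom X Z) (v : Hom Z Y) :
  is_zero Z -> is_zero_morphism f -> f = v ∘ u.
Proof.
intros [Zi Zt] (Z' & u' & v' & [Zi' _] & ->).
destruct (Zi' Z) as [w _].
now rewrite (terminal_hom_eq u (w ∘ u') Zt), comp_assoc,
  (initial_hom_eq v' (v ∘ w) Zi').
Qed.

Lemma zero_morphism_precomp (C : Category) (W X Y : C) (f : Hom X Y)
    (h : Hom W X) :
  is_zero_morphism f -> is_zero_morphism (f ∘ h).
Proof.
intros (Z & u & v & Z0 & ->).
exists Z, (u ∘ h), v; split; [exact Z0 | symmetry; apply comp_assoc].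
Qed.

Lemma is_zero_iso (C : Category) (Z X : C) (f : Hom Z X) :
  is_zero Z -> is_iso f -> is_zero X.
Proof.
intros [Zi Zt] [g [gf fg]]; split; intros Y.
- destruct (Zi Y) as [w _]; exists (w ∘ g); split; [exact I|].
  intros w' _; rewrite <- (comp_id_r w'), <- fg, comp_assoc.
  now rewrite (initial_hom_eq (w' ∘ f) w Zi).
- destruct (Zt Y) as [w _]; exists (f ∘ w); split; [exact I|].
  intros w' _; rewrite <- (comp_id_l w'), <- fg, <- comp_assoc.
  now rewrite (terminal_hom_eq (g ∘ w') w Zt).
Qed.

(** A product is a pullback over a terminal object. *)
Lemma has_binary_products (C : Category) (Z : C) :
  has_finite_limits C -> is_terminal Z ->
  forall X Y : C, exists (P : C) (p : Hom P X) (q : Hom P Y), is_product p q.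
Proof.
intros lim Zt X Y.
destruct (Zt X) as [f _], (Zt Y) as [g _].
destruct (has_pullbacks f g lim) as [P].
exists (pb_ob P), (pb_fst P), (pb_snd P); intros W h k.
apply (proj2 (pb_universal P)), terminal_hom_eq, Zt.
Qed.

(** The forgetful functor from a slice reflects jointly strongly epic pairs,
    because it preserves monomorphisms and reflects isomorphisms. *)
Lemma slice_jointly_strongly_epic (C : Category) (Y : C) (A B D : slice Y)
    (f : Hom A D) (g : Hom B D) :
  jointly_strongly_epic (proj1_sig f) (proj1_sig g) ->
  jointly_strongly_epic f g.
Proof.
intros H M m mono [f' Ef] [g' Eg].
destruct (H (slice_dom M) (proj1_sig m)) as [k [k1 k2]].
- intros W u v E.
  (* [W] lies over [Y] through [u], and equally through [v] since both agree
     after [m]. *)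
  assert (Ev : slice_arr M ∘ v = slice_arr M ∘ u).
  { now rewrite <- (proj2_sig m), <- !comp_assoc, E. }
  pose (V := {| slice_dom := W; slice_arr := slice_arr M ∘ u |} : slice Y).
  pose (u' := exist _ u eq_refl : Hom V M).
  pose (v' := exist _ v Ev : Hom V M).
  apply (f_equal (@proj1_sig _ _) (mono V u' v'
    (slice_hom_eq (h := m ∘ u') (k := m ∘ v') E))).
- exists (proj1_sig f'); now rewrite <- Ef.
- exists (proj1_sig g'); now rewrite <- Eg.
- assert (Ek : slice_arr M ∘ k = slice_arr D).
  { now rewrite <- (proj2_sig m), <- comp_assoc, k2, comp_id_r. }
  exists (exist _ k Ek : Hom D M); split; apply slice_hom_eq; assumption.
Qed.

(** Coherence of change of base, read in the category itself.  The pair is seen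
    as a cospan onto the terminal object [1_Z] of the slice over [Z]; change of
    base along [t] sends [1_Z] to a copy [T] of [1_W], so a monomorphism
    [m : M -> W] through which both pullbacks factor yields a monomorphism
    [M -> T] in the slice over [W] through which the image pair factors. *)
Lemma jointly_strongly_epic_pullback (C : Category) (X Y Z W P Q : C)
    (f : Hom X Z) (g : Hom Y Z) (t : Hom W Z)
    (p1 : Hom P X) (p : Hom P W) (q1 : Hom Q Y) (q : Hom Q W) :
  coherent_category C ->
  jointly_strongly_epic f g -> is_pullback f t p1 p -> is_pullback g t q1 q ->
  jointly_strongly_epic p q.
Proof.
intros coh fg Hp Hq M m mono [p' Ep] [q' Eq].
destruct coh as [reg cop cob].
set (lim := regular_finite_limits reg) in cob.
pose (A := {| slice_dom := X; slice_arr := f |} : slice Z).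
pose (B := {| slice_dom := Y; slice_arr := g |} : slice Z).
pose (D := {| slice_dom := Z; slice_arr := idm Z |} : slice Z).
pose (f_D := exist _ f (comp_id_l f) : Hom A D).
pose (g_D := exist _ g (comp_id_l g) : Hom B D).
pose (F := change_of_base lim t).
pose (T := chosen_pullback lim (idm Z) t).
pose (MW := {| slice_dom := M; slice_arr := m |} : slice W).
destruct (pb_lift T (h := t ∘ m) (k := m) (comp_id_l _))
  as [n [n1 n2]].
pose (n_T := exist _ n n2 : Hom MW (F D)).
assert (fac : forall (E : slice Z) (e : Hom E D) (R : C)
    (r1 : Hom R (slice_dom E)) (r : Hom R W) (r' : Hom R M),
    is_pullback (slice_arr E) t r1 r -> m ∘ r' = r ->
    exists e' : Hom (F E) MW, n_T ∘ e' = fmap F e).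
{ intros E e R r1 r r' Hr Er.
  set (K := chosen_pullback lim (slice_arr E) t).
  destruct (proj2 Hr _ _ _ (proj1 (pb_universal K))) as [u [[_ u2] _]].
  assert (Ee : m ∘ (r' ∘ u) = pb_snd K) by now rewrite comp_assoc, Er.
  exists (exist _ (r' ∘ u) Ee : Hom (F E) MW).
  apply change_of_base_map_eq.
  etransitivity; [|symmetry; apply (change_of_base_map_fst lim t e)].
  simpl; fold T K.
  rewrite comp_assoc, n1, <- comp_assoc, Ee, <- (proj1 (pb_universal K)).
  (* A morphism in the slice into [1_Z] is the structure map of its source. *)
  pose proof (proj2_sig e) as Es; simpl in Es; rewrite comp_id_l in Es.
  now rewrite Es. }
destruct (proj2 (cob W Z t) _ _ _ f_D g_D
            (slice_jointly_strongly_epic (f := f_D) (g := g_D) fg) MW n_T)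
  as [[k mk] _].
- (* [m] is subterminal in the slice: [m ∘ u] is the structure map of [V]. *)
  intros V [u Hu] [v Hv] E; apply slice_hom_eq, mono; simpl in *.
  now rewrite Hu, Hv.
- exact (fac A f_D P p1 p p' Hp Ep).
- exact (fac B g_D Q q1 q q' Hq Eq).
- (* [T -> W] has a section, so the inverse of [M -> T] makes [m] a split
     epimorphism. *)
  destruct (pb_lift T (h := t) (k := idm W)) as [s [_ s2]].
  { now rewrite comp_id_l, comp_id_r. }
  simpl in k, mk; fold T in k, mk.
  assert (Em : m ∘ (k ∘ s) = idm W) by now rewrite comp_assoc, mk.
  exists (k ∘ s); split; [|exact Em].
  apply mono; now rewrite comp_assoc, Em, comp_id_l, comp_id_r.
Qed.

(** A point [(x, 0)] of the axis [i] is on the diagonal [d] only when [x = 0].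
    Exchanging [p] and [q] gives the same for the other axis. *)
Lemma axis_diagonal_pullback (C : Category) (Z X P : C) (p q : Hom P X)
    (i d : Hom X P) (z : Hom Z X) :
  is_zero Z ->
  p ∘ i = idm X -> is_zero_morphism (q ∘ i) ->
  p ∘ d = idm X -> q ∘ d = idm X ->
  is_pullback i d z z.
Proof.
intros Z0 pi qi pd qd; split.
- apply initial_hom_eq, Z0.
- intros W h k E.
  assert (hk : h = k).
  { now rewrite <- (comp_id_l h), <- (comp_id_l k), <- pi, <- comp_assoc, E,
      comp_assoc, pd, pi. }
  subst k.
  destruct (proj2 Z0 W) as [u _].
  assert (h0 : z ∘ u = h).
  { symmetry; apply (zero_morphism_factor u z Z0).
    rewrite <- (comp_id_l h), <- qd, <- comp_assoc, <- E, comp_assoc.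
    now apply zero_morphism_precomp. }
  exists u; split; [now split|].
  intros v _; apply terminal_hom_eq, Z0.
Qed.

Theorem proposition2p10 (C : Category) (hunital : unital C)
  (hcoherent : coherent_category C) : forall X : C, is_zero X.
Proof.
intros X; destruct hunital as [[Z Z0] lim jse].
destruct (has_binary_products lim (proj2 Z0) X X) as (P & p & q & prod).
destruct (proj1 Z0 X) as [z _], (proj2 Z0 X) as [w _].
assert (zw0 : is_zero_morphism (z ∘ w)) by now exists Z, w, z.
destruct (prod X (idm X) (z ∘ w)) as [i [[pi qi] _]].
destruct (prod X (z ∘ w) (idm X)) as [j [[pj qj] _]].
destruct (prod X (idm X) (idm X)) as [d [[pd qd] _]].
rewrite <- qi in zw0; pose proof zw0 as qi0.
rewrite qi, <- pj in zw0.
apply (is_zero_iso (f := z) Z0).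
apply (jointly_strongly_epic_pullback hcoherent
         (jse X X P p q prod i j pi qi0 zw0 qj)
         (axis_diagonal_pullback z Z0 pi qi0 pd qd)
         (axis_diagonal_pullback z Z0 qj zw0 qd pd)).
- intros V u v _; apply terminal_hom_eq, Z0.
- exists (idm Z); apply comp_id_r.
- exists (idm Z); apply comp_id_r.
Qed.
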